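(* If $G$ is a triangle-free $3$-connected graph, then $G$ has a spanning forest all of whose edges are contractible in $G$. (As $G$ is connected, a spanning forest here is a spanning tree.)
   Context: Graphs are finite, nonempty and may have loops and parallel edges. A graph is $k$-connected if the removal of each set of fewer than $k$ vertices leaves a connected graph; it is not required that the graph has more than $k$ vertices, and the null graph counts as connected. An edge $e$ of a $3$-connected graph $G$ is contractible if $G/e$ is $3$-connected. A spanning forest of a graph means an edge-maximal forest with the same vertex set, that is, a spanning tree when the graph is connected. *)

(* Defs.v *)
From mathcomp Require Import all_boot.

Set Implicit Arguments.
Unset Strict Implicit.
Unset Printing Implicit Defensive.

(* Finite undirected graphs, loops and parallel edges allowed: [ends e] is the
   set of end-vertices of [e], a singleton exactly when [e] is a loop.  The
   null graph is allowed here, since deleting vertices may produce it. *)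
Record mgraph := MGraph {
  vertex : finType;
  edge : finType;
  ends : edge -> {set vertex};
  card_ends : forall e, 0 < #|ends e| <= 2
}.

Definition adj (G : mgraph) : rel (vertex G) :=
  fun x y => [exists e : edge G, ends e == [set x; y]].

Definition connected (G : mgraph) : Prop :=
  forall x y : vertex G, connect (@adj G) x y.

Section Delete.
Variables (G : mgraph) (X : {set vertex G}).

Definition del_vertex : finType := {v : vertex G | v \notin X}.
Definition del_edge : finType := {f : edge G | [disjoint ends f & X]}.
Definition del_ends (f : del_edge) : {set del_vertex} :=
  [set v | val v \in ends (val f)].

Lemma card_del_ends f : 0 < #|del_ends f| <= 2.
Proof.
suff <- : #|ends (val f)| = #|del_ends f| by apply: card_ends.
rewrite -(card_imset _ val_inj); congr #|pred_of_set _|.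
apply/setP=> v; apply/idP/imsetP => [vf | [u]]; last first.
  by rewrite inE => uf ->.
have vX : v \notin X by rewrite (disjointFr (valP f)).
by exists (Sub v vX : del_vertex) => //; rewrite inE.
Qed.

Definition delete : mgraph := MGraph card_del_ends.
End Delete.

(* No lower bound on the number of vertices is required. *)
Definition k_connected (k : nat) (G : mgraph) : Prop :=
  forall X : {set vertex G}, #|X| < k -> connected (delete X).

Section Contract.
Variables (G : mgraph) (e : edge G).

(* The vertices of G/e are the classes of the partition of the vertex set of G
   into [ends e] and singletons.  All edges other than [e] are kept, so an edge
   parallel to [e] becomes a loop. *)
Definition contract_class (v : vertex G) : {set vertex G} :=
  if v \in ends e then ends e else [set v].

Definition contract_vertex : finType :=
  {S : {set vertex G} | S \in [set contract_class v | v : vertex G]}.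
Definition contract_edge : finType := {f : edge G | f != e}.

Definition contract_proj (v : vertex G) : contract_vertex :=
  exist _ (contract_class v) (imset_f contract_class (isT : v \in predT)).

Definition contract_ends (f : contract_edge) : {set contract_vertex} :=
  [set contract_proj v | v in ends (val f)].

Lemma card_contract_ends f : 0 < #|contract_ends f| <= 2.
Proof.
have /andP[f0 f2] := card_ends (val f).
rewrite (leq_trans (leq_imset_card _ _) f2) andbT card_gt0.
by rewrite imset_eq0 -card_gt0.
Qed.

Definition contract : mgraph := MGraph card_contract_ends.
End Contract.

Definition contractible (G : mgraph) (e : edge G) : Prop :=
  k_connected 3 (contract e).

Definition triangle_free (G : mgraph) : Prop :=
  forall x y z : vertex G,
    x != y -> y != z -> x != z -> ~ [/\ adj x y, adj y z & adj x z].

(* A cycle v_0 e_0 v_1 e_1 ... v_(n-1) e_(n-1) v_0, n >= 1, is given by the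
   list of the pairs (v_i, e_i); a loop is a cycle with n = 1, and two parallel
   edges form a cycle with n = 2. *)
Definition is_cycle (G : mgraph) (c : seq (vertex G * edge G)) : bool :=
  [&& c != [::],
      cycle (fun p q => ends p.2 == [set p.1; q.1]) c,
      uniq (unzip1 c) & uniq (unzip2 c)].

(* [F] stands for the subgraph of G with all the vertices of G and edge set F. *)
Definition is_forest (G : mgraph) (F : {set edge G}) : Prop :=
  forall c, is_cycle c -> ~ {subset unzip2 c <= F}.

Definition spanning_forest (G : mgraph) (F : {set edge G}) : Prop :=
  is_forest F /\
  (forall F' : {set edge G}, is_forest F' -> F \subset F' -> F' = F).

(* Main.v *)
Require Import Defs.
From mathcomp Require Import all_boot.
From mathcomp Require Import zify.

(** It suffices that every cut (A, ~A) is crossed by a contractible edge: a tree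
    of contractible edges can then be grown until it spans.  A non-contractible
    edge has both ends in a 3-vertex separator.  If all the edges across the cut
    are non-contractible, choose a crossing edge xy, a 3-separator S containing
    x and y and a side D of S with |D| minimal.  Some crossing edge uv has u in
    D and v in S or D; let T be a 3-separator containing u and v, with sides E
    and E'.  Uncrossing S and T, minimality forces one of the following: a side
    of S or T is a single vertex adjacent to the whole separator, hence to the
    ends of xy or of uv; or D is a subset of T, and two adjacent vertices of D
    have a common neighbour in S.  Each of them yields a triangle. *)

Set Implicit Arguments.
Unset Strict Implicit.
Unset Printing Implicit Defensive.

(** * Adjacency, separators and their sides *)

Lemma ends_set2 (G : mgraph) (e : edge G) : exists x y, ends e = [set x; y].
Proof.
have /andP[e0] := card_ends e; rewrite leq_eqVlt => /orP[/cards2P[x [y [_ ->]]]|].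
  by exists x, y.
rewrite ltnS => e1; have /cards1P[x ->] : #|ends e| == 1 by rewrite eqn_leq e1.
by exists x, x; rewrite setUid.
Qed.

Lemma adjC (G : mgraph) : symmetric (@adj G).
Proof. by move=> x y; rewrite /adj; apply: eq_existsb => e; rewrite setUC. Qed.

Definition far (G : mgraph) (S D : {set vertex G}) := ~: (S :|: D).

(** The side [D] is a union of components of G - S, not necessarily a single one. Hence [far S D] is
    again a side, and so may be a proper part of [D]. *)
Definition separates (G : mgraph) (S D : {set vertex G}) : bool :=
  [&& D != set0, far S D != set0, [disjoint S & D]
    & [forall x in D, forall y, adj x y ==> (y \in S :|: D)]].

Lemma separatesP (G : mgraph) (S D : {set vertex G}) :
  reflect [/\ D != set0, far S D != set0, [disjoint S & D]
            & forall x y, x \in D -> adj x y -> y \in S :|: D]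
          (separates S D).
Proof.
apply: (iffP and4P) => -[D0 F0 SD clD]; split=> //.
  by move=> x y xD xy; move/forall_inP/(_ x xD)/forallP/(_ y)/implyP: clD; apply.
by apply/forall_inP=> x xD; apply/forallP=> y; apply/implyP; apply: clD.
Qed.

Lemma far_far (G : mgraph) (S D : {set vertex G}) :
  [disjoint S & D] -> far S (far S D) = D.
Proof.
move=> SD; apply/setP=> x; rewrite !inE; case xS: (x \in S) => //=.
  by rewrite (disjointFr SD xS).
by rewrite negbK.
Qed.

Lemma separates_far (G : mgraph) (S D : {set vertex G}) :
  separates S D -> separates S (far S D).
Proof.
case/separatesP=> D0 F0 SD clD; apply/separatesP; rewrite far_far //.
split=> //.
  rewrite -setI_eq0 -subset0; apply/subsetP=> x.
  by rewrite !inE; case: (x \in S).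
move=> x y; rewrite !inE => /norP[xS xD] xy.
case yS: (y \in S) => //=; apply/negP=> yD; rewrite adjC in xy.
by have := clD y x yD xy; rewrite inE (negPf xS) (negPf xD).
Qed.

(** [D] is closed under adjacency in [delete S], so no path there leads from [D] to [far S D]. *)
Lemma k_connected_separates (G : mgraph) k (S D : {set vertex G}) :
  k_connected k G -> separates S D -> k <= #|S|.
Proof.
move=> Gk /separatesP[/set0Pn[x xD] /set0Pn[y]].
rewrite !inE => /norP[yS yD] SD clD; rewrite leqNgt; apply/negP=> /Gk conn.
have xS : x \notin S by rewrite (disjointFl SD xD).
have := conn (Sub x xS) (Sub y yS).
have sub u v : @adj (delete S) u v -> adj (val u) (val v).
  case/existsP=> f /eqP fE; apply/existsP; exists (val f).
  have uf : u \in @ends (delete S) f by rewrite fE !inE eqxx.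
  have vf : v \in @ends (delete S) f by rewrite fE !inE eqxx orbT.
  apply/eqP/setP=> w; rewrite !inE; apply/idP/idP=> [wf|]; last first.
    by case/orP=> /eqP->; [move: uf | move: vf]; rewrite inE.
  have wS : w \notin S by rewrite (disjointFr (valP f)).
  have : (Sub w wS : del_vertex S) \in @ends (delete S) f by rewrite inE.
  by rewrite fE !inE -!val_eqE.
have cl : closed (@adj (delete S)) [pred v | val v \in D].
  apply: intro_closed; first exact: (sym_connect_sym (@adjC _)).
  move=> u v /sub uv; rewrite !inE => uD; have := clD _ _ uD uv.
  by rewrite inE (negPf (valP v)).
by move/(closed_connect cl); rewrite !inE /= xD (negPf yD).
Qed.

(** A vertex of [S] without neighbours in [D] could be moved to the far side, leaving a separator
    with fewer than [k] vertices. *)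
Lemma separates_neighbor (G : mgraph) k (S D : {set vertex G}) s :
  k_connected k G -> separates S D -> #|S| = k -> s \in S ->
  exists2 d, d \in D & adj s d.
Proof.
move=> Gk sepSD cardS sS; apply/exists_inP; apply: contraT.
rewrite negb_exists => /forallP noN.
case/separatesP: (sepSD) => D0 /set0Pn[f] fF SD clD.
suff /(k_connected_separates Gk) : separates (S :\ s) D.
  by rewrite -cardS (cardsD1 s S) sS ltnn.
apply/separatesP; split=> //.
- apply/set0Pn; exists f; move: fF.
  by rewrite !inE !negb_or negb_and => /andP[-> ->]; rewrite orbT.
- by rewrite (disjointWl (subD1set _ _)).
- move=> x y xD xy; have := clD x y xD xy; rewrite !inE.
  by case: eqP => //= ys; move: xy (noN x); rewrite ys adjC xD => ->.
Qed.

(** * Obstructed edges and contraction *)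

(* A vertex cut of size at most 2 in G/e lifts to a separator of size 3 in G
   containing both ends of e. *)
Definition obstructed (G : mgraph) (e : edge G) : bool :=
  [exists S : {set vertex G}, exists D : {set vertex G},
    [&& separates S D, #|S| == 3 & ends e \subset S]].

Lemma contract_proj_eq (G : mgraph) (e : edge G) u v :
  contract_proj e u = contract_proj e v ->
  u = v \/ (u \in ends e) && (v \in ends e).
Proof.
move/(congr1 val); rewrite /= /contract_class.
case: ifP => ue; case: ifP => ve; first by right.
- by move=> eE; move: ve; rewrite eE inE eqxx.
- by move=> eE; move: ue; rewrite -eE inE eqxx.
- by move/set1_inj; left.
Qed.

Lemma adj_contract (G : mgraph) (e : edge G) u v : adj u v ->
  contract_proj e u = contract_proj e v \/
  @adj (contract e) (contract_proj e u) (contract_proj e v).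
Proof.
case/existsP=> f /eqP fE; have [fe | fe] := eqVneq f e.
  by left; apply: val_inj; rewrite /= /contract_class -fe fE !inE !eqxx orbT.
right; apply/existsP; exists (Sub f fe); apply/eqP.
by rewrite /= /contract_ends /= fE imsetU1 imset_set1.
Qed.

Lemma adj_delete (G : mgraph) (X : {set vertex G}) (u v : vertex (delete X)) :
  adj (val u) (val v) -> adj u v.
Proof.
case/existsP=> f /eqP fE.
have fX : [disjoint ends f & X].
  rewrite fE -setI_eq0 -subset0; apply/subsetP=> w; rewrite !inE.
  by case/andP=> /orP[] /eqP-> wX; [move: (valP u) | move: (valP v)]; rewrite wX.
apply/existsP; exists (Sub f fX); apply/eqP/setP=> w.
by rewrite !inE fE !inE -!val_eqE.
Qed.

(** If at most two vertices [X] separate [a] from [b] in G/e, then the preimage [S] of [X] separates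
    in G the preimage [D] of the component of [a]. By 3-connectivity [S] has at least three
    vertices, which forces it to contain both ends of [e]. *)
Lemma unobstructed_contractible (G : mgraph) (e : edge G) :
  k_connected 3 G -> ~~ obstructed e -> contractible e.
Proof.
move=> G3 good X X3 a b; apply/negPn/negP => nab; case/negP: good.
pose pr := contract_proj e.
pose S := pr @^-1: X.
pose D := [set v | [exists w : vertex (delete X),
  (val w == pr v) && connect (@adj _) a w]].
have prS v : (v \in S) = (pr v \in X) by rewrite inE.
have pr_surj (w : contract_vertex e) : exists v, pr v = w.
  by case/imsetP: (valP w) => v _ wE; exists v; apply: val_inj; rewrite wE.
have DP v (vX : pr v \notin X) :
    (v \in D) = connect (@adj (delete X)) a (Sub (pr v) vX).
  rewrite inE; apply/existsP/idP=> [[w /andP[/eqP wv]] | av].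
    by congr (connect _ _ _); apply: val_inj.
  by exists (Sub (pr v) vX); rewrite eqxx.
have SD : [disjoint S & D].
  rewrite -setI_eq0 -subset0; apply/subsetP=> v; rewrite in_setI prS inE.
  case/andP=> vX /existsP[w /andP[/eqP wv _]].
  by move: (valP w); rewrite wv vX.
have sepSD : separates S D.
  apply/separatesP; split=> //.
  - have [v va] := pr_surj (val a); apply/set0Pn; exists v; rewrite inE.
    by apply/existsP; exists a; rewrite va eqxx connect0.
  - have [v vb] := pr_surj (val b); apply/set0Pn; exists v.
    have vX : pr v \notin X by rewrite vb (valP b).
    rewrite inE in_setU prS negb_or vX (DP v vX).
    suff -> : Sub (pr v) vX = b by [].
    exact: val_inj.
  - move=> u v uD uv; rewrite in_setU prS.
    case: (boolP (pr v \in X)) => //= vX.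
    have uX : pr u \notin X by rewrite -prS (disjointFl SD uD).
    rewrite (DP u uX) in uD; rewrite (DP v vX).
    case: (adj_contract e uv) => [uv_eq | uv'].
      suff -> : Sub (pr v) vX = Sub (pr u) uX :> vertex (delete X) by [].
      exact: val_inj.
    apply: connect_trans uD (connect1 _).
    exact: adj_delete.
have S3 := k_connected_separates G3 sepSD.
(* Only the ends of [e] are identified by [pr], so [pr] is injective once one end is removed. If [z]
   were outside [S], this would bound [S] itself by 2. *)
have cardSD1 z : z \in ends e -> #|S :\ z| <= 2.
  move=> ze; rewrite -ltnS; apply: leq_trans X3; rewrite ltnS.
  have prX : pr @: (S :\ z) \subset X.
    by apply/subsetP=> _ /imsetP[v /setD1P[_ vS] ->]; rewrite -prS.
  rewrite -(card_in_imset (f := pr)) ?subset_leq_card // => u v.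
  rewrite !inE => /andP[uz _] /andP[vz _] /contract_proj_eq[] // /andP[].
  have [x [y eE]] := ends_set2 e; move: ze uz vz; rewrite eE !inE.
  by case/orP=> /eqP-> ux vx /orP[] /eqP uE /orP[] /eqP vE;
    move: ux vx; rewrite uE vE ?eqxx.
have endsS : ends e \subset S.
  apply/subsetP=> z ze; apply/negPn/negP=> zS.
  by move: S3; rewrite ltnNge (cardsD1 z S) (negPf zS) (cardSD1 z ze).
apply/existsP; exists S; apply/existsP; exists D.
rewrite sepSD endsS andbT eqn_leq S3 andbT.
have /set0Pn[z ze] : ends e != set0.
  by rewrite -card_gt0; case/andP: (card_ends e).
rewrite (cardsD1 z S) (subsetP endsS z ze) ltnS; exact: cardSD1.
Qed.

(** * Uncrossing two 3-separators *)

Lemma card_separated (G : mgraph) (S T E : {set vertex G}) :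
  [disjoint T & E] -> #|S| = #|S :&: T| + #|S :&: E| + #|S :&: far T E|.
Proof.
move=> TE; rewrite -(cardsID T S) -(cardsID E (S :\: T)) addnA.
congr (_ + _ + _); apply: eq_card => x; rewrite !inE.
  case xT: (x \in T) => //=; first by rewrite (disjointFr TE xT) andbF.
by case: (x \in S); case: (x \in T); case: (x \in E).
Qed.

(** All neighbours of [D :&: E] outside it lie here, since they lie in both [S :|: D] and
    [T :|: E]. *)
Definition corner (G : mgraph) (S D T E : {set vertex G}) :=
  S :&: T :|: S :&: E :|: T :&: D.

Lemma separates_corner (G : mgraph) (S D T E : {set vertex G}) :
  separates S D -> separates T E -> D :&: E != set0 ->
  separates (corner S D T E) (D :&: E).
Proof.
case/separatesP=> _ /set0Pn[f fF] SD clD /separatesP[_ _ TE clE] DE0.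
apply/separatesP; split=> //.
- apply/set0Pn; exists f; move: fF; rewrite !inE.
  by case: (f \in S) => //=; case: (f \in D); rewrite ?andbF.
- rewrite -setI_eq0 -subset0; apply/subsetP=> x; rewrite !inE.
  case/and3P=> + xD xE.
  by rewrite (disjointFl SD xD) (disjointFl TE xE).
move=> x y; rewrite inE => /andP[xD xE] xy.
move: (clD x y xD xy) (clE x y xE xy); rewrite !inE.
by do 4![case: (y \in _)].
Qed.

(* The corner separators of [D :&: E] and of the opposite intersection have at
   most 6 vertices in total, and minimality of D gives the former at least 4. *)
Lemma corner_opposite (G : mgraph) (S D T E : {set vertex G}) u v :
  k_connected 3 G -> separates S D -> separates T E -> #|S| = 3 -> #|T| = 3 ->
  u \in D -> v \in S :|: D -> u \in T -> v \in T ->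
  (forall K C, separates K C -> #|K| = 3 -> u \in K -> v \in K ->
     #|D| <= #|C|) ->
  D :&: E != set0 ->
  3 < #|S :&: T| + #|S :&: E| + #|T :&: D| /\ far S D :&: far T E = set0.
Proof.
move=> G3 sepD sepE S3 T3 uD vSD uT vT minD DE0.
have [[_ _ SD _] [_ _ TE _]] := (separatesP _ _ sepD, separatesP _ _ sepE).
have corner_le A B : #|corner S A T B| <= #|S :&: T| + #|S :&: B| + #|T :&: A|.
  rewrite (leq_trans (leq_card_setU _ _)) // leq_add2r.
  exact: leq_card_setU.
have sepC := separates_corner sepD sepE DE0.
have gt3 : 3 < #|S :&: T| + #|S :&: E| + #|T :&: D|.
  apply: leq_trans (corner_le _ _); rewrite ltn_neqAle.
  (* A corner of size 3 would contain [u] and [v] and have the side [D :&: E], which is smaller than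
     [D] because it misses [u]. *)
  rewrite (k_connected_separates G3 sepC) andbT; apply/eqP=> C3.
  have uC : u \in corner S D T E by rewrite !inE uD uT !orbT.
  have vC : v \in corner S D T E.
    by move: vSD; rewrite !inE vT; case: (v \in S).
  have := minD _ _ sepC (esym C3) uC vC; apply/negP; rewrite -ltnNge.
  apply: proper_card; apply/properP; split; first exact: subsetIl.
  by exists u; rewrite // inE (disjointFr TE uT) andbF.
split=> //; apply/eqP; apply: contraT => FF0.
have := k_connected_separates G3
  (separates_corner (separates_far sepD) (separates_far sepE) FF0).
move: gt3 (corner_le (far S D) (far T E)).
move: (card_separated S TE) (card_separated T SD).
rewrite S3 T3 (setIC T S); clear; lia.
Qed.

Lemma triangle_free_adj (G : mgraph) (x y z : vertex G) :
  triangle_free G -> x != y -> z != x -> z != y ->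
  adj x y -> adj z x -> adj z y -> False.
Proof.
by move=> Gtf xy zx zy axy azx azy; apply: (Gtf z x y) => //; rewrite eq_sym.
Qed.

(** Otherwise the corner opposite to [D :&: far T E] is empty as well, so [E] lies in [S]. Counting
    leaves a single vertex in [E]; it is adjacent to all of [T], hence forms a triangle with [u] and
    [v]. *)
Lemma corner_empty_left (G : mgraph) (S D T E : {set vertex G}) u v :
  k_connected 3 G -> triangle_free G ->
  separates S D -> separates T E -> #|S| = 3 -> #|T| = 3 ->
  u != v -> adj u v -> u \in D -> v \in S :|: D -> u \in T -> v \in T ->
  (forall K C, separates K C -> #|K| = 3 -> u \in K -> v \in K ->
     #|D| <= #|C|) ->
  D :&: E = set0 -> D :&: far T E = set0.
Proof.
move=> G3 Gtf sepD sepE S3 T3 uNv uv uD vSD uT vT minD DE0.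
apply/eqP; apply: contraT => DF0.
have [[_ _ SD clD] [/set0Pn[s sE] _ TE clE]] :=
  (separatesP _ _ sepD, separatesP _ _ sepE).
have [gt3] := corner_opposite G3 sepD (separates_far sepE) S3 T3 uD vSD uT vT
  minD DF0.
rewrite far_far // => FE0.
have sub_ES : E \subset S.
  apply/subsetP=> x xE; apply: contraT => xS.
  have xD : x \notin D.
    by apply/negP=> xD; move/setP/(_ x): DE0; rewrite !inE xD xE.
  by move/setP/(_ x): FE0; rewrite !inE (negPf xS) (negPf xD) xE.
(* The neighbour [t] puts a vertex of [T] in [far S D], so [u] and [v] are the only vertices of [T]
   in [S :|: D]. With [gt3] this leaves at least two vertices of [S] in [far T E] and at most one in
   [E]. *)
have [t tF st] := separates_neighbor G3 (separates_far sepD) S3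
  (subsetP sub_ES s sE).
have tT : t \in T.
  have := clE s t sE st; rewrite inE => /orP[] // tE.
  by move/setP/(_ t): FE0; rewrite inE tF tE inE.
have E1 : E = [set s].
  apply/eqP; rewrite eq_sym eqEcard sub1set sE cards1 -(setIidPr sub_ES) /=.
  have tTF : 0 < #|T :&: far S D|.
    by rewrite card_gt0; apply/set0Pn; exists t; rewrite inE tT.
  have uvT : 1 < #|T :&: S| + #|T :&: D|.
    rewrite -cardsUI (leq_trans _ (leq_addr _ _)) //.
    rewrite (leq_trans _ (subset_leq_card (A := [set u; v]) _)) ?cards2 ?uNv //.
    apply/subsetP=> w; rewrite !inE -andb_orr => /orP[] /eqP->.
      by rewrite uT uD orbT.
    by move: vSD; rewrite vT inE.
  have := card_separated S TE; have := card_separated T SD.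
  move: gt3; rewrite S3 T3 (setIC S T) .
  move=> gt3 eT eS; clear -gt3 eT eS tTF uvT; lia.
have nb w : w \in T -> adj w s.
  case/(separates_neighbor G3 sepE T3)=> d.
  by rewrite E1 inE => /eqP->.
have sNT w : w \in T -> s != w.
  by move=> wT; apply: contraTneq wT => <-; rewrite (disjointFl TE sE).
by case: (triangle_free_adj Gtf uNv (sNT _ uT) (sNT _ vT) uv); rewrite adjC nb.
Qed.

(** The sets [D :&: E] and [D :&: far T E] are both empty or both nonempty. In the first case [D]
    lies in [T]; in the second [far S D] does, and is a single vertex. *)
Lemma crossing_separators (G : mgraph) (S D T E : {set vertex G}) x y u v :
  k_connected 3 G -> triangle_free G ->
  separates S D -> separates T E -> #|S| = 3 -> #|T| = 3 ->
  x != y -> adj x y -> x \in S -> y \in S ->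
  u != v -> adj u v -> u \in D -> v \in S :|: D -> u \in T -> v \in T ->
  (forall C, separates S C -> #|D| <= #|C|) ->
  (forall K C, separates K C -> #|K| = 3 -> u \in K -> v \in K ->
     #|D| <= #|C|) ->
  False.
Proof.
move=> G3 Gtf sepD sepE S3 T3 xNy xy xS yS uNv uv uD vSD uT vT minS minD.
have [[_ _ SD clD] [_ _ TE clE]] :=
  (separatesP _ _ sepD, separatesP _ _ sepE).
have sepE' := separates_far sepE; have sepD' := separates_far sepD.
have FF := far_far TE.
have SN w s : w \notin S -> s \in S -> w != s.
  by move=> wS sS; apply: contraNneq wS => ->.
have left_empty :=
  corner_empty_left G3 Gtf sepD _ S3 T3 uNv uv uD vSD uT vT minD.
have [DE0 | DE0] := eqVneq (D :&: E) set0.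
  have DF0 := left_empty _ sepE DE0.
  have DT : D \subset T.
    apply/subsetP=> w wD; move/setP/(_ w): DE0; move/setP/(_ w): DF0.
    by rewrite !inE wD /= => /negbFE; case: (w \in T) => //= ->.
  (* As [w] is in [T], it has a neighbour in each side [B] of [T]; that neighbour is not in [D], so
     it is in [S]. *)
  have nbS B w : separates T B -> D :&: B = set0 -> w \in D ->
      exists2 s, s \in S :&: B & adj w s.
    move=> sepB DB0 wD.
    have [s sB ws] := separates_neighbor G3 sepB T3 (subsetP DT w wD).
    exists s => //; rewrite inE sB andbT.
    have := clD w s wD ws; rewrite inE => /orP[] // sD.
    by move/setP/(_ s): DB0; rewrite !inE sD sB.
  case: (boolP [exists d in D, (d != u) && adj u d]) => [|noN].
    case/exists_inP=> d dD /andP[du ud].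
    (* A common neighbour of the adjacent vertices [u] and [d] would give a triangle. So [S] has two
       vertices in each of [E] and [far T E], which is too many. *)
    have two B : separates T B -> D :&: B = set0 -> 1 < #|S :&: B|.
      move=> sepB DB0; have [s sSB us] := nbS B u sepB DB0 uD.
      have [s' sSB' ds'] := nbS B d sepB DB0 dD.
      have sNs' : s != s'.
        apply/eqP=> ss; rewrite -ss adjC in ds'; rewrite adjC in us.
        have sS : s \in S by case/setIP: sSB.
        apply: (triangle_free_adj (x := u) (y := d) (z := s) Gtf) => //.
        - by rewrite eq_sym.
        - by apply: contraTneq sS => ->; rewrite (disjointFl SD uD).
        - by apply: contraTneq sS => ->; rewrite (disjointFl SD dD).
      rewrite (leq_trans _ (subset_leq_card (A := [set s; s']) _)) ?cards2 ?sNs' //.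
      apply/subsetP=> w; move: sSB sSB'.
      by rewrite !inE => ? ? /orP[] /eqP->.
    move: (card_separated S TE) (two _ sepE DE0) (two _ sepE' DF0).
    rewrite S3; clear; lia.
  have uS : u \notin S by rewrite (disjointFl SD uD).
  (* Without neighbours in [D], the vertex [u] alone is a side of [S]. Minimality makes it all of
     [D], so [u] is adjacent to [x] and [y]. *)
  have sepu : separates S [set u].
    apply/separatesP; split.
    - by apply/set0Pn; exists u; rewrite inE.
    - case/separatesP: sepD => _ /set0Pn[f fF] _ _; apply/set0Pn; exists f.
      move: fF; rewrite !inE !negb_or => /andP[-> fD] /=.
      by apply: contraNneq fD => ->.
    - by rewrite disjoint_sym disjoints1.
    - move=> w z /set1P-> uz; have := clD u z uD uz.
      rewrite !inE => /orP[-> // | zD]; apply/orP; right.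
      apply: contraNT noN => zu; apply/exists_inP; exists z => //.
      by rewrite zu.
  have D1 : D = [set u].
    by apply/eqP; rewrite eq_sym eqEcard sub1set uD (minS _ sepu).
  have nb s : s \in S -> adj u s.
    case/(separates_neighbor G3 sepD S3)=> d.
    by rewrite D1 inE adjC => /eqP->.
  by apply: (triangle_free_adj Gtf xNy _ _ xy (nb _ xS) (nb _ yS)); apply: SN.
have DF0 : D :&: far T E != set0.
  by apply: contra_neq DE0 => /(left_empty _ sepE'); rewrite FF.
have [_ FFE] := corner_opposite G3 sepD sepE S3 T3 uD vSD uT vT minD DE0.
have [gt3] := corner_opposite G3 sepD sepE' S3 T3 uD vSD uT vT minD DF0.
rewrite FF => FE.
(* Both opposite corners are empty, so [far S D] misses [E] and [far T E]. *)
have FT : far S D \subset T.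
  apply/subsetP=> w wF; apply: contraT => wT.
  move/setP/(_ w): FFE; move/setP/(_ w): FE; rewrite !(in_setI, wF) /= !inE.
  by rewrite (negPf wT) /= => ->.
have [w wF xw] := separates_neighbor G3 sepD' S3 xS.
have [w' wF' yw] := separates_neighbor G3 sepD' S3 yS.
(* Two of the three vertices of [T] are [u] and [v], which lie outside [far S D]. Hence the
   neighbours of [x] and [y] in [far S D] coincide. *)
have F1 : #|far S D| <= 1.
  have uvT : 1 < #|T :&: S| + #|T :&: D|.
    rewrite -cardsUI (leq_trans _ (leq_addr _ _)) //.
    rewrite (leq_trans _ (subset_leq_card (A := [set u; v]) _)) ?cards2 ?uNv //.
    apply/subsetP=> z; rewrite !inE -andb_orr => /orP[] /eqP->.
      by rewrite uT uD orbT.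
    by move: vSD; rewrite vT inE.
  move: uvT (card_separated T SD); rewrite T3 (setIidPr FT); clear; lia.
have ww : w' = w by apply: (card_le1_eqP F1).
rewrite {}ww in yw wF'.
have wS : w \notin S by move: wF; rewrite !inE => /norP[].
by apply: (triangle_free_adj Gtf xNy (SN _ _ wS xS) (SN _ _ wS yS) xy); rewrite adjC.
Qed.

(** * An unobstructed edge across every cut *)

Lemma cut_unobstructed (G : mgraph) (A : {set vertex G}) :
  k_connected 3 G -> triangle_free G -> A != set0 -> ~: A != set0 ->
  exists e u v, [/\ ends e = [set u; v], u \in A, v \notin A & ~~ obstructed e].
Proof.
move=> G3 Gtf A0 A0'.
pose cross u v := adj u v && ((u \in A) != (v \in A)).
have crossC u v : cross u v = cross v u by rewrite /cross adjC eq_sym.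
have crossN u v : cross u v -> u != v.
  by case/andP=> _; apply: contraNneq => ->.
pose cover u v (p : {set vertex G} * {set vertex G}) :=
  [&& separates p.1 p.2, #|p.1| == 3, u \in p.1 & v \in p.1].
have [e /= /existsP[u /existsP[v /and4P[/eqP eE uA vA ge]]] | none] :=
  pickP [pred e | [exists u, exists v,
    [&& ends e == [set u; v], u \in A, v \notin A & ~~ obstructed e]]].
  by exists e, u, v.
have coverP u v : cross u v -> exists p, cover u v p.
  wlog uA : u v / u \in A.
    move=> wl uv; case: (boolP (u \in A)) => [/wl/(_ uv) // | uA].
    have vA : v \in A by case/andP: uv; rewrite (negPf uA); case: (v \in A).
    have [|p] := wl v u vA; first by rewrite crossC.
    by case/and4P=> ? ? ? ?; exists p; apply/and4P.
  case/andP=> /existsP[e /eqP eE]; rewrite uA eq_sym eqb_id => vA.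
  have : obstructed e.
    apply: contraFT (none e) => ge; apply/existsP; exists u.
    by apply/existsP; exists v; rewrite eE eqxx uA vA.
  case/existsP=> S /existsP[D /and3P[sepD S3 eS]]; exists (S, D).
  by rewrite /cover sepD S3 !(subsetP eS) // eE !inE eqxx ?orbT.
(* The crossing edge is quantified here, so the minimum of |D| ranges over all crossing edges at
   once and applies to both [xy] and [uv]. *)
pose bad p := [exists u, exists v, cross u v && cover u v p].
have badI u v p : cross u v -> cover u v p -> bad p.
  by move=> uv cp; apply/existsP; exists u; apply/existsP; exists v; rewrite uv.
have [p0 bad0] : exists p, bad p.
  case: (boolP [exists u, exists v, cross u v]) => [|noX].
    case/existsP=> u /existsP[v uv]; have [p] := coverP u v uv.
    by exists p; apply: badI uv _.
  (* Without crossing edges the empty set would separate [A] from its complement. *)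
  suff /(k_connected_separates G3) : separates set0 A by rewrite cards0.
  apply/separatesP; split=> //; first by rewrite /far set0U.
    by rewrite -setI_eq0 set0I.
  move=> u v uA uv; rewrite set0U; apply: contraNT noX => vA.
  by apply/existsP; exists u; apply/existsP; exists v; rewrite /cross uv uA (negPf vA).
pose size2 (p : {set vertex G} * {set vertex G}) := #|p.2|.
exfalso; case: (arg_minnP size2 bad0) => -[S D] badSD minD {p0 bad0}.
case/existsP: badSD => x /existsP[y /andP[xy]].
case/and4P=> /= sepD /eqP S3 xS yS.
have minS C : separates S C -> #|D| <= #|C|.
  by move=> sepC; apply: (minD (S, C)); apply: (badI x y) => //;
    rewrite /cover sepC S3 eqxx xS.
have clash u v : cross u v -> u \in D -> v \in S :|: D -> False.
  move=> uv uD vSD; have [[T E] /and4P[/= sepE /eqP T3 uT vT]] := coverP u v uv.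
  have [/andP[axy _] /andP[auv _]] := (xy, uv).
  apply: (crossing_separators G3 Gtf sepD sepE S3 T3 (crossN x y xy) axy xS yS
    (crossN u v uv) auv uD vSD uT vT minS) => K C sepK K3 uK vK.
  by apply: (minD (K, C)); apply: (badI u v) => //;
    rewrite /cover sepK K3 eqxx uK.
(* By [clash] no crossing edge joins [D] to [S :|: D], so a neighbour in [D] of [s] is on the same
   side of the cut as [s]. *)
have side s : s \in S -> exists2 d, d \in D & (d \in A) = (s \in A).
  move=> sS; have [d dD sd] := separates_neighbor G3 sepD S3 sS.
  exists d => //; apply/eqP; apply: contraT => ds.
  by case: (clash d s) => //; rewrite ?inE ?sS // /cross adjC sd.
have [d dD dA] := side x xS; have [d' dD' dA'] := side y yS.
(* Since [x] and [y] are on different sides of the cut, [D] meets both sides. With no crossing edge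
   inside [D], the part on the side of [x] is a strictly smaller side of [S], against minimality. *)
have /minS : separates S [set w in D | (w \in A) == (x \in A)].
  case/separatesP: sepD => _ /set0Pn[f fF] SD clD; apply/separatesP; split.
  - by apply/set0Pn; exists d; rewrite inE dD dA eqxx.
  - apply/set0Pn; exists f; move: fF.
    by rewrite !inE !negb_or => /andP[-> /negPf->].
  - by apply: disjointWr SD; apply/subsetP=> w; rewrite inE => /andP[].
  - move=> u v; rewrite inE => /andP[uD /eqP uA] uv; have vSD := clD u v uD uv.
    have := vSD; rewrite !inE => /orP[-> // | vD].
    rewrite vD -uA /= eq_sym; apply/orP; right; apply: contraT => vA.
    by case: (clash u v) => //; rewrite /cross uv.
apply/negP; rewrite -ltnNge; apply: proper_card; apply/properP; split.
  by apply/subsetP=> w; rewrite inE => /andP[].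
exists d' => //; rewrite inE dD' dA' /= eq_sym.
by case/andP: xy.
Qed.

(** * Forests and the growth of a spanning tree *)

Definition forest_adj (G : mgraph) (F : {set edge G}) : rel (vertex G) :=
  fun u v => [exists e in F, ends e == [set u; v]].

Lemma forest_adjC (G : mgraph) (F : {set edge G}) : symmetric (forest_adj F).
Proof. by move=> u v; apply: eq_existsb => e; rewrite setUC. Qed.

Lemma is_cycle_rot (G : mgraph) n (c : seq (vertex G * edge G)) :
  is_cycle (rot n c) = is_cycle c.
Proof.
rewrite /is_cycle rot_cycle /unzip1 /unzip2 !map_rot !rot_uniq.
by rewrite -!size_eq0 size_rot.
Qed.

(** A cycle using [e] passes through [v], where it needs two distinct edges or a loop; but [e] is
    the only edge at [v] and is not a loop. *)
Lemma is_forest_add_leaf (G : mgraph) (F : {set edge G}) e u v :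
  is_forest F -> ends e = [set u; v] -> u != v ->
  (forall f, f \in F -> v \notin ends f) -> is_forest (e |: F).
Proof.
move=> forF eE uv vF c cyc cF.
have edge_v f : f \in unzip2 c -> v \in ends f -> f = e.
  by move/cF/setU1P=> [// | /vF/negPf->].
have [ec|ec] := boolP (e \in unzip2 c); last first.
  apply: (forF c cyc) => f fc; have /setU1P[fe|//] := cF f fc.
  by rewrite fe (negPf ec) in fc.
have vc : v \in unzip1 c.
  case/mapP: ec => p pc eq_e; case/and4P: cyc => _ cyc _ _.
  have /eqP pE := next_cycle cyc pc.
  have : v \in [set p.1; (next c p).1] by rewrite -pE -eq_e eE !inE eqxx orbT.
  rewrite !inE => /orP[] /eqP->; first exact: map_f.
  by apply: map_f; rewrite mem_next.
case/mapP: vc => p pc vp.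
(* After rotation the cycle starts at [v], so its first and last edges both meet [v] and must both
   be [e]. *)
have [i c' cE] := rot_to pc.
have c'P : {subset unzip2 (p :: c') <= unzip2 c}.
  by rewrite -cE => f; rewrite /unzip2 map_rot mem_rot.
rewrite -(is_cycle_rot i) cE in cyc; case/and4P: cyc => _ /= cyc _.
have p2 : p.2 = e.
  apply: edge_v; first by apply: c'P; rewrite inE eqxx.
  by case: (c') cyc => [|q c''] /= /andP[/eqP-> _]; rewrite vp !inE eqxx.
case/lastP: c' cE c'P cyc => [_ _ | c' q _ c'P].
  rewrite /= p2 eE andbT -vp setUid => /eqP/setP/(_ u).
  by rewrite !inE eqxx (negPf uv).
rewrite rcons_path last_rcons => /andP[_ /eqP qE] /andP[/negP[]].
rewrite p2 -(edge_v q.2).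
- by rewrite /unzip2 map_rcons mem_rcons inE eqxx.
- by apply: c'P; rewrite /= inE /unzip2 map_rcons mem_rcons inE eqxx orbT.
- by rewrite qE vp !inE eqxx orbT.
Qed.

(** This puts a path in the format of [is_cycle]. The last vertex is paired with an arbitrary [e],
    meant as the closing edge; [sorted] does not constrain it. The bound on [ends f] serves the
    induction: the new edge meets [u], which is not on the rest of the path, so it is not
    repeated. *)
Lemma path_edges (G : mgraph) (F : {set edge G}) u p e :
  path (forest_adj F) u p -> uniq (u :: p) ->
  exists (c : seq (vertex G * edge G)) (es : seq (edge G)),
    [/\ unzip1 c = u :: p,
        sorted (fun p q => ends p.2 == [set p.1; q.1]) c,
        unzip2 c = rcons es e,
        {subset es <= F} /\ uniq es
      & forall f, f \in es -> ends f \subset u :: p].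
Proof.
elim: p u => [|v p IHp] u.
  by move=> _ _; exists [:: (u, e)], [::]; split.
case/andP=> /exists_inP[e0 e0F /eqP e0E] vp /andP[uvp Uvp].
have [c [es [c1 sc c2 [esF Ues] es_sub]]] := IHp v vp Uvp.
exists ((u, e0) :: c), (e0 :: es); split=> //=.
- by rewrite c1.
- by case: c c1 sc {c2} => //= q c [-> _] ->; rewrite e0E eqxx.
- by rewrite c2.
- split; first by move=> f; rewrite inE => /orP[/eqP-> | /esF].
  rewrite Ues andbT; apply: contra uvp => /es_sub/subsetP; apply.
  by rewrite e0E !inE eqxx.
- move=> f; rewrite inE => /orP[/eqP-> | /es_sub/subsetP fs].
    rewrite e0E; apply/subsetP=> w; rewrite !inE.
    by case/orP=> /eqP->; rewrite eqxx ?orbT.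
  by apply/subsetP=> w /fs wvp; rewrite inE wvp orbT.
Qed.

(** An additional edge [e] closes the path in [F] between its ends to a cycle. *)
Lemma connected_spanning_forest (G : mgraph) (F : {set edge G}) :
  is_forest F -> (forall u v, connect (forest_adj F) u v) -> spanning_forest F.
Proof.
move=> forF conF; split=> // F' forF' sFF'; apply/eqP.
rewrite eq_sym eqEsubset sFF'; apply/subsetP=> e eF'; apply: contraT => eF.
have [u [v eE]] := ends_set2 e.
have /connectP[p0 p0P vE] := conF u v.
case/shortenP: p0P vE => p pP Up _ vE.
have [c [es [c1 sc c2 [esF Ues] _]]] := path_edges e pP Up.
case: (forF' c); last first.
  by move=> f; rewrite c2 mem_rcons inE => /orP[/eqP-> // | /esF/(subsetP sFF')].
have c0 : c != [::] by apply: contra_eqN c1 => /eqP->.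
rewrite /is_cycle c0 c1 c2 Up rcons_uniq Ues (contra (esF e) eF) /= !andbT.
case/lastP: c c0 c1 c2 sc => // c [z e1] _ c1 c2 sc.
have e1E : e1 = e.
  by move: c2; rewrite /unzip2 map_rcons => /rcons_inj[].
have zE : z = v by rewrite vE -(last_cons u) -c1 /unzip1 map_rcons last_rcons.
(* If the path is trivial, then [e] is a loop and the cycle has length one. *)
case: c c1 {c2} sc => [|q c] /= [qu _];
  last rewrite !rcons_path last_rcons => -> /=.
  by rewrite e1E eE -qu -zE eqxx.
by rewrite qu e1E zE eE setUC.
Qed.

(** Starting from one vertex, each step adds an unobstructed edge across the cut between [W] and its
    complement. As the edges of [F] stay inside [W], the new vertex is a leaf. *)
Lemma grow_tree (G : mgraph) n :
  k_connected 3 G -> triangle_free G -> n < #|vertex G| ->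
  exists (W : {set vertex G}) (F : {set edge G}),
    [/\ #|W| = n.+1, is_forest F, forall e, e \in F -> ends e \subset W,
        forall e, e \in F -> ~~ obstructed e
      & {in W &, forall u v, connect (forest_adj F) u v}].
Proof.
move=> G3 Gtf; elim: n => [|n IHn] nG.
  have /card_gt0P[v _] := nG; exists [set v], set0; split.
  - by rewrite cards1.
  - case=> [|p c] // _ sub; have := sub p.2; rewrite inE eqxx => /(_ isT).
    by rewrite inE.
  - by move=> e; rewrite inE.
  - by move=> e; rewrite inE.
  - by move=> u w /set1P-> /set1P->.
have [W [F [Wn forF FW good conF]]] := IHn (ltnW nG).
have W0 : W != set0 by rewrite -card_gt0 Wn.
have W0' : ~: W != set0.
  by rewrite -card_gt0 -(ltn_add2l #|W|) cardsC addn0 Wn.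
have [e [u [v [eE uW vW ge]]]] := cut_unobstructed G3 Gtf W0 W0'.
have sub_adj : subrel (connect (forest_adj F)) (connect (forest_adj (e |: F))).
  apply: connect_sub => x y /exists_inP[f fF xy]; apply/connect1/exists_inP.
  by exists f; rewrite // inE fF orbT.
have symF := sym_connect_sym (@forest_adjC G (e |: F)).
have con_u x : x \in v |: W -> connect (forest_adj (e |: F)) u x.
  case/setU1P=> [-> | xW]; last exact/sub_adj/conF.
  by apply/connect1/exists_inP; exists e; rewrite ?eE // setU11.
exists (v |: W), (e |: F); split.
- by rewrite cardsU1 vW Wn.
- apply: (is_forest_add_leaf forF eE).
    by apply: contraNneq vW => <-.
  by move=> f /FW/subsetP fW; apply: contra vW => /fW.
- move=> f /setU1P[-> | /FW fW]; last exact: subset_trans fW (subsetUr _ _).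
  rewrite eE; apply/subsetP=> w; rewrite !inE.
  by case/orP=> /eqP->; rewrite ?uW ?eqxx ?orbT.
- by move=> f /setU1P[-> | /good].
- by move=> x y xW yW; rewrite (connect_trans _ (con_u y yW)) // symF con_u.
Qed.

Theorem corollary6 (G : mgraph) (G_nonempty : 0 < #|vertex G|)
    (G_3connected : k_connected 3 G) (G_triangle_free : triangle_free G) :
  exists F : {set edge G},
    spanning_forest F /\ (forall e : edge G, e \in F -> contractible e).
Proof.
(* A tree indexed by [n] has [n.+1] vertices, so the predecessor of the order of G gives all of
   them, G being nonempty. *)
have [|W [F [Wn forF _ good conF]]] :=
  grow_tree (n := #|vertex G|.-1) G_3connected G_triangle_free.
  by rewrite prednK.
have WT : W = setT.
  by apply/eqP; rewrite eqEcard subsetT cardsT Wn prednK /=.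
exists F; split=> [|e /good]; last exact: unobstructed_contractible.
by apply: connected_spanning_forest => // u v; apply: conF; rewrite WT inE.
Qed.
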